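(* Let $\ell$ be an odd prime and let $f(\zeta)$ be a symmetric unimodal Laurent polynomial that is divisible by $\Phi_\ell(\zeta)$. Then the coefficients of the Laurent polynomial $\frac{f(\zeta)}{\Phi_\ell(\zeta)}$ are non-negative.
   Context: Laurent polynomials have rational coefficients, i.e. lie in $\mathbb{Q}[\zeta^{-1},\zeta]$. For a prime $\ell$, $\Phi_\ell(\zeta):=1+\zeta+\cdots+\zeta^{\ell-1}$. ''Divisible by $\Phi_\ell(\zeta)$'' means $f(\zeta)=g(\zeta)\Phi_\ell(\zeta)$ for some $g(\zeta)\in\mathbb{Q}[\zeta^{-1},\zeta]$. A Laurent polynomial $f$ is symmetric if $f(\zeta^{-1})=f(\zeta)$. A Laurent polynomial $f(\zeta)=\sum_m a_m\zeta^m$ (with $a_m=0$ outside a finite range, $m$ running over all integers) is unimodal if there exists $k\in\mathbb{Z}$ such that $a_m\le a_{m+1}$ for all $m\le k$ and $a_m\ge a_{m+1}$ for all $m>k$. *)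

(* Defs.v *)
From HB Require Import structures.
From mathcomp Require Import all_boot all_order all_algebra.
From mathcomp Require Import finmap monalg.

Set Implicit Arguments.
Unset Strict Implicit.
Unset Printing Implicit Defensive.

Import Order.TTheory GRing.Theory Num.Theory.

Local Open Scope ring_scope.
Local Open Scope fset_scope.

(* Q[zeta^-1, zeta]: finitely supported functions int -> rat, f@_m being the
   coefficient of zeta^m and <<c *g m>> the monomial c zeta^m. The product of
   monalg requires a monoid of exponents without units, which excludes int;
   hence the ring structure below. *)
Definition laurent : Type := {malg rat[int]}.
Bind Scope ring_scope with laurent.

HB.instance Definition _ := GRing.Zmodule.on laurent.

Section LaurentRing.

Implicit Types (f g h : laurent) (i j : int) (c : rat).

Definition laurent_mul f g : laurent :=
  \sum_(i <- msupp f) \sum_(j <- msupp g) << f@_i * g@_j *g (i + j)%R >>.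

Let laurent_mulw (A B : {fset int}) f g :
    msupp f `<=` A -> msupp g `<=` B ->
  laurent_mul f g =
    \sum_(i <- A) \sum_(j <- B) << f@_i * g@_j *g (i + j)%R >>.
Proof.
move=> sfA sgB; rewrite /laurent_mul (big_fset_incl _ sfA) /=.
  apply: eq_bigr => i _; apply: big_fset_incl => // j _ /mcoeff_outdom ->.
  by rewrite mulr0 monalgU0.
move=> i _ /mcoeff_outdom fi0.
by rewrite big1 => // j _; rewrite fi0 mul0r monalgU0.
Qed.

Lemma laurent_mulC : commutative laurent_mul.
Proof.
move=> f g; rewrite /laurent_mul exchange_big.
by do 2!apply: eq_bigr => ? _; rewrite mulrC addrC.
Qed.

Lemma laurent_mulDl : left_distributive laurent_mul +%R.
Proof.
move=> f g h.
rewrite (laurent_mulw (msuppD_le f g) (fsubset_refl _)).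
rewrite (laurent_mulw (fsubsetUl _ (msupp g)) (fsubset_refl _)).
rewrite (laurent_mulw (fsubsetUr (msupp f) _) (fsubset_refl _)).
rewrite -big_split /=; apply: eq_bigr => i _.
rewrite -big_split /=; apply: eq_bigr => j _.
by rewrite mcoeffD mulrDl monalgUD.
Qed.

Let laurent_mulDr : right_distributive laurent_mul +%R.
Proof. by move=> f g h; rewrite -!(laurent_mulC _ f) laurent_mulDl. Qed.

Let laurent_mul0l : left_zero 0 laurent_mul.
Proof. by move=> f; rewrite /laurent_mul msupp0 big_seq_fset0. Qed.

Let laurent_mul0r : right_zero 0 laurent_mul.
Proof. by move=> f; rewrite laurent_mulC laurent_mul0l. Qed.

Let laurent_mulUl c i g :
  laurent_mul << c *g i >> g = \sum_(j <- msupp g) << c * g@_j *g (i + j)%R >>.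
Proof.
rewrite (laurent_mulw msuppU_le (fsubset_refl _)) big_seq_fset1.
by apply: eq_bigr => j _; rewrite mcoeffUU.
Qed.

Let laurent_mulUU c d i j :
  laurent_mul << c *g i >> << d *g j >> = << c * d *g (i + j)%R >>.
Proof. by rewrite (laurent_mulw msuppU_le msuppU_le) !big_seq_fset1 !mcoeffUU. Qed.

Let laurent_mul_suml (r : seq int) (F : int -> laurent) g :
  laurent_mul (\sum_(i <- r) F i) g = \sum_(i <- r) laurent_mul (F i) g.
Proof. exact: (big_morph (laurent_mul^~ g) (fun _ _ => laurent_mulDl _ _ _)). Qed.

Let laurent_mul_sumr (r : seq int) (F : int -> laurent) g :
  laurent_mul g (\sum_(i <- r) F i) = \sum_(i <- r) laurent_mul g (F i).
Proof. exact: (big_morph (laurent_mul g) (fun _ _ => laurent_mulDr _ _ _)). Qed.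

Let laurent_mulEl f g :
  laurent_mul f g = \sum_(i <- msupp f) laurent_mul << f@_i *g i >> g.
Proof. by apply: eq_bigr => i _; rewrite laurent_mulUl. Qed.

Let laurent_mulEr f g :
  laurent_mul f g = \sum_(j <- msupp g) laurent_mul f << g@_j *g j >>.
Proof.
by rewrite laurent_mulC laurent_mulEl; apply: eq_bigr => j _; rewrite laurent_mulC.
Qed.

Lemma laurent_mulA : associative laurent_mul.
Proof.
move=> f g h.
rewrite laurent_mulEl [in RHS](laurent_mulEl f) laurent_mul_suml.
apply: eq_bigr => i _.
rewrite (laurent_mulEl g) laurent_mul_sumr (laurent_mulEr _ g) laurent_mul_suml.
apply: eq_bigr => j _.
rewrite (laurent_mulEr _ h) laurent_mul_sumr [RHS]laurent_mulEr.
by apply: eq_bigr => k _; rewrite !laurent_mulUU mulrA addrA.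
Qed.

Lemma laurent_mul1 : left_id (<< 0%R >> : laurent) laurent_mul.
Proof.
move=> f; rewrite laurent_mulUl [RHS]monalgE.
by apply: eq_bigr => i _; rewrite mul1r add0r.
Qed.

Lemma laurent_1neq0 : (<< 0%R >> : laurent) != 0.
Proof. by rewrite monalgU_eq0. Qed.

End LaurentRing.

HB.instance Definition _ := GRing.Zmodule_isComNzRing.Build laurent
  laurent_mulA laurent_mulC laurent_mul1 laurent_mulDl laurent_1neq0.

Definition zeta : laurent := << 1%R >>.

Definition Phi (l : nat) : laurent := \sum_(i < l) zeta ^+ i.

(* f(zeta^-1) *)
Definition laurent_inv (f : laurent) : laurent :=
  \sum_(m <- msupp f) << f@_m *g (- m)%R >>.

Definition laurent_symmetric (f : laurent) : Prop := laurent_inv f = f.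

Definition laurent_unimodal (f : laurent) : Prop :=
  exists k : int,
    (forall m : int, m <= k -> f@_m <= f@_(m + 1)%R) /\
    (forall m : int, k < m -> f@_(m + 1)%R <= f@_m).

Lemma mcoeff_laurentM_zetaX (f : laurent) (n : nat) (m : int) :
  (f * zeta ^+ n)@_m = f@_(m - n%:Z)%R.
Proof.
have zX : zeta ^+ n = << n%:Z >> :> laurent.
  elim: n => [|n IHn] //.
  rewrite exprS IHn; apply: etrans (_ : << 1 * 1 *g (1 + n%:Z)%R >> = _).
    apply/malgP => k; rewrite /GRing.mul /= /laurent_mul.
    by rewrite !msuppU oner_eq0 !big_seq_fset1 !mcoeffUU.
  by rewrite mulr1 intS.
rewrite zX [LHS](_ : _ = (\sum_(i <- msupp f) << f@_i *g (i + n%:Z)%R >>)@_m).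
  rewrite [f in RHS]monalgE !raddf_sum; apply: eq_bigr => i _.
  by rewrite /= !mcoeffU -(inj_eq (addIr (- n%:Z))) addrK.
congr (_ @_ m); apply: eq_bigr => i _.
by rewrite msuppU oner_eq0 big_seq_fset1 mcoeffUU mulr1.
Qed.

(* Quotients by Phi l are unique, so f = g * Phi l determines g. *)
Lemma Phi_rreg (l : nat) : (0 < l)%N -> GRing.rreg (Phi l).
Proof.
move=> l_gt0 g h /eqP; rewrite -subr_eq0 -mulrBl => /eqP dP0.
apply/eqP; rewrite -subr_eq0; apply/eqP; set d := g - h in dP0 *.
have dz : d * zeta ^+ l = d.
  by apply/eqP; rewrite -subr_eq0 -{2}[d]mulr1 -mulrBr subrX1 mulrCA dP0 mulr0.
have per (n : nat) m : d@_m = d@_(m - (l * n)%N%:Z)%R.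
  elim: n m => [|n IHn] m; first by rewrite muln0 subr0.
  by rewrite IHn -[d in LHS]dz mcoeff_laurentM_zetaX mulnS addnC PoszD opprD addrA.
apply/malgP => m; rewrite mcoeff0; apply/eqP; apply/negPn/negP => dm.
pose F (n : 'I_(size (msupp d)).+1) := (m - (l * n)%N%:Z)%R.
have F_inj : injective F.
  move=> a b /addrI /oppr_inj [] /eqP; rewrite eqn_pmul2l // => /eqP.
  exact: val_inj.
have : (size (map F (enum 'I_(size (msupp d)).+1)) <= size (msupp d))%N.
  apply: uniq_leq_size; first by rewrite map_inj_uniq // enum_uniq.
  by move=> _ /mapP[n _ ->]; rewrite -mcoeff_neq0 -per.
by rewrite size_map size_enum_ord ltnn.
Qed.

(* Main.v *)
Require Import Defs.
From mathcomp Require Import all_boot all_order all_algebra.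
From mathcomp Require Import finmap monalg.
From mathcomp Require Import zify.

Import Order.TTheory GRing.Theory Num.Theory.

Local Open Scope ring_scope.

(** Multiplying f = g * Phi l by zeta - 1 telescopes Phi l into zeta ^+ l - 1,
    so that, coefficientwise, f_m - f_(m-1) = g_m - g_(m-l)
    ([mcoeff_mulPhi_step]).  A symmetric unimodal f can be taken to peak at 0
    ([symmetric_unimodal_le]), so the left-hand side is >= 0 for m <= 0 and
    <= 0 for m >= 1.  Hence, starting from m <= 0, the coefficients of g do not
    increase along m, m - l, m - 2l, ..., and starting from m >= 0 they do not
    increase along m, m + l, m + 2l, ....  Either progression leaves the finite
    support of g, so its terms reach 0 and the first one, g_m, is
    non-negative ([mcoeff_ge0_along]). *)

Lemma mcoeff_eventually0 (g : laurent) (s : nat -> int) :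
  injective s -> exists n, g@_(s n) = 0.
Proof.
move=> s_inj; set N := size (msupp g).
have [/allP sg|] := boolP (all (mem (msupp g)) (map s (iota 0 N.+1))).
  have := uniq_leq_size _ sg; rewrite map_inj_uniq // iota_uniq => /(_ isT).
  by rewrite size_map size_iota ltnn.
move=> /allPn[_ /mapP[n _ ->] /mcoeff_outdom gn0].
by exists n.
Qed.

Lemma mcoeff_ge0_along (g : laurent) (s : nat -> int) :
    injective s -> (forall n, g@_(s n.+1) <= g@_(s n)) ->
  0 <= g@_(s 0%N).
Proof.
move=> s_inj s_dec; have [n <-] := mcoeff_eventually0 g s s_inj.
by elim: n => // n; apply: le_trans.
Qed.

(** Comparison of coefficients in g * Phi l * (zeta - 1) = g * (zeta ^+ l - 1),
    which trades the l-term convolution with Phi l for a two-term recurrence. *)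
Lemma mcoeff_mulPhi_step (l : nat) (g : laurent) (m : int) :
  (g * Phi l)@_m - (g * Phi l)@_(m - 1) = g@_m - g@_(m - l%:Z).
Proof.
(* The exponent 1 is kept so that both shifts are read off by the same lemma. *)
have mulE : g * Phi l * zeta ^+ 1 - g * Phi l = g * zeta ^+ l - g.
  rewrite -[X in _ - X = _]mulr1 -[X in _ = _ - X]mulr1 -!mulrBr.
  by rewrite expr1 subrX1 -mulrA (mulrC (Phi l)).
have := congr1 (fun h : laurent => h@_m) mulE.
rewrite !mcoeffB !mcoeff_laurentM_zetaX => diffE.
by rewrite -opprB diffE opprB.
Qed.

Lemma mcoeff_symmetric (f : laurent) (m : int) :
  laurent_symmetric f -> f@_(- m) = f@_m.
Proof.
move=> fS; rewrite -[in LHS]fS /laurent_inv [f in RHS]monalgE !raddf_sum.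
by apply: eq_bigr => i _; rewrite /= !mcoeffU eqr_opp.
Qed.

(** The k given by unimodality need not put the peak at 0.  If k < m - 1, the
    coefficients do not increase from m on, so f_(1-m) <= f_m; by symmetry the
    left-hand side is f_(m-1). *)
Lemma symmetric_unimodal_le (f : laurent) (m : int) :
    laurent_symmetric f -> laurent_unimodal f ->
  m <= 0 -> f@_(m - 1) <= f@_m.
Proof.
move=> fS [k [f_inc f_dec]] m_le0.
have [m_le|k_lt] := leP (m - 1) k; first by have := f_inc _ m_le; rewrite subrK.
have f_anti (n : nat) : f@_(m + n%:Z) <= f@_m.
  elim: n => [|n IHn]; first by rewrite addr0.
  apply: le_trans IHn.
  have -> : m + n.+1%:Z = m + n%:Z + 1 by lia.
  by apply: f_dec; lia.
(* Since 1 - m - m >= 0, the index on the right is 1 - m, the mirror of m - 1. *)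
have -> : f@_(m - 1) = f@_(m + (absz (1 - m - m)%R)%:Z).
  by rewrite -mcoeff_symmetric //; congr (f@_ _); lia.
exact: f_anti.
Qed.

Theorem lemma3p1 (l : nat) (f g : laurent)
  (l_prime : prime l) (l_odd : odd l)
  (f_symmetric : laurent_symmetric f) (f_unimodal : laurent_unimodal f)
  (f_div_Phi : f = g * Phi l) :
  forall m : int, 0 <= g@_m.
Proof.
move=> m; have l_gt0 := prime_gt0 l_prime.
have step (i : int) : f@_i - f@_(i - 1) = g@_i - g@_(i - l%:Z).
  by rewrite f_div_Phi mcoeff_mulPhi_step.
have f_le (i : int) : i <= 0 -> f@_(i - 1) <= f@_i.
  exact: symmetric_unimodal_le.
have f_ge (i : int) : 1 <= i -> f@_i <= f@_(i - 1).
  move=> i_ge1; rewrite -mcoeff_symmetric // -[leRHS]mcoeff_symmetric //.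
  have -> : - i = - (i - 1) - 1 by lia.
  by apply: f_le; lia.
have [m_le0|m_gt0] := leP m 0.
- pose s (n : nat) : int := m - (l * n)%N%:Z.
  have -> : m = s 0%N by rewrite /s; lia.
  apply: mcoeff_ge0_along => [a b|n]; first by rewrite /s; nia.
  have -> : s n.+1 = s n - l%:Z by rewrite /s; lia.
  by rewrite -subr_ge0 -step subr_ge0; apply: f_le; rewrite /s; lia.
- pose s (n : nat) : int := m + (l * n)%N%:Z.
  have -> : m = s 0%N by rewrite /s; lia.
  apply: mcoeff_ge0_along => [a b|n]; first by rewrite /s; nia.
  have -> : s n = s n.+1 - l%:Z by rewrite /s; lia.
  by rewrite -subr_le0 -step subr_le0; apply: f_ge; rewrite /s; lia.
Qed.
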